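(* Let $P\in\mathbb{Z}[X]$ be a polynomial of degree $d$ and let $\alpha$ and $\beta$ be two of its roots such that $\Im\alpha\neq\Im\beta$. Then $$|\Im\alpha-\Im\beta|\gg\begin{cases} \mathrm{H}(P)^{-(d-1)}, & \text{if } \Im\alpha=0,\\ \mathrm{H}(P)^{-3(d-1)(d-2)/2}, & \text{if } \Re\alpha=0,\\ \mathrm{H}(P)^{-(d-1)(d-2)(d-3)/2}, & \text{otherwise.} \end{cases}$$
   Context: The roots are the complex roots of $P$, and $\Re$ and $\Im$ denote real and imaginary parts. The height $\mathrm{H}(P)$ of a polynomial $P$ is the maximum of the absolute values of its coefficients. The positive constant implicit in the sign $\gg$ depends only on the degree $d$.
   Formalization: The second bound is stated only for d > 2 and the third only for d > 3; in lower degrees the exponent is 0 and the bound fails, e.g. for nX^2+1, nX^2+X+1 and (nX^2+X+1)(X-1) as n grows. *)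

(* Defs.v *)
From HB Require Import structures.
From mathcomp Require Import all_boot all_order all_algebra.
From mathcomp Require Import reals.
From mathcomp Require Import complex.

Set Implicit Arguments.
Unset Strict Implicit.
Unset Printing Implicit Defensive.

Import Order.TTheory GRing.Theory Num.Theory.

Local Open Scope ring_scope.

Definition height (P : {poly int}) : nat := \max_(i < size P) `|(P`_i)%R|%N.

Definition complex_root (R : realType) (P : {poly int}) (z : complex R) : bool :=
  root (map_poly (intr : int -> complex R) P) z.

(* Main.v *)
(* Let h_1, ..., h_d be the roots of P with multiplicity, a its leading
   coefficient, and L = sum_j c_j X_j an integer linear form in m variables. A
   symmetric integer polynomial of degree at most N in each variable, evaluated
   at the roots and multiplied by a^N, is an integer. Apply this to an elementary
   symmetric polynomial of the forms L(X_s(1), ..., X_s(m)), s ranging over the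
   injections, where N = m (d-1) ... (d-m+1): taking its degree to be the number
   of forms not vanishing at the roots leaves a single product, so that
   |a|^N prod |L(h_s)| >= 1 over the nonvanishing forms. If t of the values have
   the same absolute value x, bounding the others by the Mahler measure gives
   x^t >> H(P)^-N, that is x >> H(P)^-(N/t). Use this with
   - X - Y at (beta, conj beta), where N = 2(d-1) and t = 2;
   - 2X - Y + Z at (alpha, beta, conj beta) and its conjugate when Re alpha = 0,
     where N = 3(d-1)(d-2) and t = 2;
   - X - Y - Z + W at (alpha, conj alpha, beta, conj beta), where
     N = 4(d-1)(d-2)(d-3) and t = 8 by the symmetries of the form.
   When beta is real or conjugate to alpha, the first bound suffices. *)
Require Import Defs.
From HB Require Import structures.
From mathcomp Require Import all_boot all_order all_algebra.
From mathcomp Require Import reals.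
From mathcomp Require Import complex.
From mathcomp Require Import fingroup perm.
From mathcomp Require Import ssrcomplements mpoly.
From mathcomp Require Import ring zify.

Set Implicit Arguments.
Unset Strict Implicit.
Unset Printing Implicit Defensive.

Import Order.TTheory GRing.Theory Num.Theory.
Local Open Scope ring_scope.

(** * Polynomials of bounded degree in each variable *)

Section BoundedSupport.

Variables (n : nat) (R : comNzRingType).
Implicit Types (p q : {mpoly R[n]}) (b : 'X_{1..n}).

(** The degree is bounded in each variable separately: this, and not the total degree, governs the
    power of the leading coefficient that clears denominators. *)
Definition supp_le b p := all (fun m => (m <= b)%MM) (msupp p).

Lemma supp_leP b p :
  reflect (forall m, m \in msupp p -> forall i, (m i <= b i)%N) (supp_le b p).
Proof.
apply: (iffP allP) => h m /h; first by move/mnm_lepP.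
by move=> ?; apply/mnm_lepP.
Qed.

Lemma supp_le_trans b1 b2 p : (b1 <= b2)%MM -> supp_le b1 p -> supp_le b2 p.
Proof.
by move=> h12 /allP h; apply/allP => m /h h1; exact: lepm_trans h1 h12.
Qed.

Lemma supp_leB b p q : supp_le b p -> supp_le b q -> supp_le b (p - q).
Proof.
move=> /allP hp /allP hq; apply/allP => m /msuppB_le.
by rewrite mem_cat => /orP[/hp|/hq].
Qed.

Lemma supp_leZ b c p : supp_le b p -> supp_le b (c *: p).
Proof. by move=> /allP hp; apply/allP => m /msuppZ_le /hp. Qed.

Lemma supp_le_sum (I : Type) (r : seq I) (P : pred I) (F : I -> {mpoly R[n]}) b :
  (forall i, P i -> supp_le b (F i)) -> supp_le b (\sum_(i <- r | P i) F i).
Proof.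
move=> h; elim/big_rec: _ => [|i p Pi hp]; first by rewrite /supp_le msupp0.
apply/allP => m /msuppD_le; rewrite mem_cat => /orP[] mF.
  by have /allP := h i Pi; exact.
by move/allP: hp; exact.
Qed.

Lemma supp_leM b1 b2 p q :
  supp_le b1 p -> supp_le b2 q -> supp_le (b1 + b2)%MM (p * q).
Proof.
move=> /supp_leP hp /supp_leP hq; apply/supp_leP => m /msuppM_le.
move=> /allpairsP[[m1 m2] /= [h1 h2 ->]] i.
by rewrite !mnmDE leq_add ?hp ?hq.
Qed.

Lemma supp_le1 : supp_le 0%MM (1 : {mpoly R[n]}).
Proof. by rewrite /supp_le msupp1 /= lepm_refl. Qed.

Lemma supp_le_prod (I : Type) (r : seq I) (P : pred I)
    (F : I -> {mpoly R[n]}) (b : I -> 'X_{1..n}) :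
  (forall i, P i -> supp_le (b i) (F i)) ->
  supp_le (\sum_(i <- r | P i) b i)%MM (\prod_(i <- r | P i) F i).
Proof.
move=> h; elim/big_rec2: _ => [|i m p Pi hp]; first exact: supp_le1.
by apply: supp_leM => //; exact: h.
Qed.

Lemma supp_leX b p k : supp_le b p -> supp_le (b *+ k)%MM (p ^+ k).
Proof.
move=> hp; elim: k => [|k ih]; first by rewrite mulm0n expr0 supp_le1.
by rewrite exprS mulmS; exact: supp_leM.
Qed.

Lemma supp_le_mesym k : supp_le [multinom 1%N | i < n] (mesym n R k).
Proof.
apply/supp_leP => m; rewrite msupp_mesymP => /existsP[h /andP[_ /eqP->]] i.
by rewrite !mnmE; case: (i \in h).
Qed.

End BoundedSupport.

(** * Symmetric polynomials evaluated at the roots *)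

(* Reducing [p] by the product of elementary symmetric polynomials with the same
   leading monomial [m] keeps the degree in each variable below [N]: that product
   has [m 0] factors, each of degree 1 in every variable. *)
Lemma sym_eval (n : nat) (R : comNzRingType) (K : comNzRingType)
    (f : {rmorphism R -> K}) (h : 'I_n -> K) (a : K) (N : nat) (p : {mpoly R[n]}) :
  p \is symmetric -> supp_le [multinom N | i < n] p ->
  (exists z, f z = a) ->
  (forall k : 'I_n, exists z, f z = a * mmap f h (mesym n R k.+1)) ->
  exists z, f z = a ^+ N * mmap f h p.
Proof.
move=> symp bp [za Ea] hk; elim/mleadrect: p => p ih in symp bp *.
case/and3P: (symf1P symp) => hlt sym2 /eqP Ep.
have [p0|nz_p] := eqVneq p 0.
  by exists 0; rewrite p0 !rmorph0 mulr0.
move: hlt sym2 Ep; rewrite /symf1 (negbTE nz_p) /=.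
set c := nth 0%N (mlead p); set F := [multinom _ | _ < _].
(* Here [F i] is [c i - c i.+1]. The exponents [c] of the leading monomial of a symmetric polynomial
   are nonincreasing, also past the end, where they default to 0; so the sum telescopes to at most
   [c 0]. *)
have leF : (\sum_i F i <= N)%N.
  have -> : (\sum_i F i = \sum_(0 <= i < n) (c i - c i.+1))%N.
    by rewrite big_mkord; apply: eq_bigr => i _; rewrite mnmE.
  have srt := mlead_msym_sorted symp.
  rewrite sum0n_range; last first.
    move=> i j /andP[leij]; rewrite ltnS leq_eqVlt => /predU1P[->|ltj].
      by rewrite /c nth_default // size_tuple.
    have lti := leq_ltn_trans leij ltj.
    have := srt (Ordinal lti) (Ordinal ltj) leij.
    by rewrite !(mnm_nth 0%N).
  apply: leq_trans (leq_subr _ _) _.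
  case: (posnP n) => [n0|n0].
    by rewrite /c nth_default // size_tuple n0.
  move/supp_leP: bp => /(_ _ (mlead_supp nz_p) (Ordinal n0)).
  by rewrite mnmE (mnm_nth 0%N).
set S := [tuple _ | _ < _]; set q := 'X_[_] \mPo S.
have Eq : q = \prod_(i < n) mesym n R i.+1 ^+ F i.
  rewrite /q comp_mpolyX; apply: eq_bigr => i _.
  by rewrite tnth_map tnth_ord_tuple.
have bq : supp_le [multinom N | i < n] q.
  rewrite Eq; apply: supp_le_trans; last first.
    by apply: supp_le_prod => i _; apply: supp_leX; exact: supp_le_mesym.
  apply/mnm_lepP => i; rewrite mnm_sumE mnmE; apply: leq_trans leF.
  by apply: leq_sum => j _; rewrite mulmnE mnmE mul1n.
have [zq Ezq] : exists z, f z = a ^+ N * mmap f h q.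
  (* Each elementary symmetric factor absorbs one [a]; the remaining ones are themselves in the
     image of [f]. *)
  have -> : a ^+ N = a ^+ (N - \sum_i F i) * \prod_i a ^+ F i.
    by rewrite prodrXr -exprD subnK.
  rewrite Eq rmorph_prod -mulrA -big_split /=.
  have /fin_all_exists [z Ez] := hk.
  exists (za ^+ (N - \sum_i F i) * \prod_i z i ^+ F i).
  rewrite rmorphM rmorphXn Ea rmorph_prod; congr (_ * _).
  by apply: eq_bigr => i _; rewrite rmorphXn Ez rmorphXn exprMn.
move=> hlt sym2 _; set r := p - _ in hlt sym2.
have [zr Ezr] : exists z, f z = a ^+ N * mmap f h r.
  case/orP: hlt => [/eqP->|ltr]; first by exists 0; rewrite !rmorph0 mulr0.
  by apply: ih => //; apply: supp_leB => //; apply: supp_leZ.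
exists (zr + p@_(mlead p) * zq).
rewrite rmorphD rmorphM Ezr Ezq /r rmorphB /= mmapZ.
by rewrite mulrBr mulrCA subrK.
Qed.

(** Vieta's formulas. The index 0 is included, where they say that [a] is the image of the leading
    coefficient. *)
Lemma mesym_roots (n : nat) (R : comNzRingType) (K : idomainType)
    (f : {rmorphism R -> K}) (h : 'I_n -> K) (a : K) (P : {poly R}) (k : 'I_n.+1) :
  map_poly f P = a *: \prod_(i < n) ('X - (h i)%:P) ->
  a * mmap f h (mesym n R k) = f ((-1) ^+ k * P`_(n - k)).
Proof.
move=> EP; rewrite rmorphM rmorph_sign -coef_map EP coefZ.
have := mroots_coeff [tuple h i | i < n] k.
rewrite big_tuple (eq_bigr (fun i => 'X - (h i)%:P)); last first.
  by move=> i _; rewrite tnth_map tnth_ord_tuple.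
move=> ->; rewrite mulrCA signrMK /mesym !rmorph_sum; congr (_ * _).
apply: eq_bigr => A _; rewrite !rmorph_prod; apply: eq_bigr => i _.
by rewrite /= mmapX mmap1U mevalXU tnth_map tnth_ord_tuple.
Qed.

Lemma sym_eval_roots (n : nat) (R : comNzRingType) (K : idomainType)
    (f : {rmorphism R -> K}) (h : 'I_n -> K) (a : K) (P : {poly R}) (N : nat)
    (p : {mpoly R[n]}) :
  map_poly f P = a *: \prod_(i < n) ('X - (h i)%:P) ->
  p \is symmetric -> supp_le [multinom N | i < n] p ->
  exists z, f z = a ^+ N * mmap f h p.
Proof.
move=> EP symp bp; apply: sym_eval => // [|k].
  exists P`_n; have := mesym_roots ord0 EP.
  by rewrite mesym0E rmorph1 mulr1 expr0 mul1r subn0.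
by exists ((-1) ^+ k.+1 * P`_(n - k.+1)); rewrite -(mesym_roots (lift ord0 k) EP).
Qed.

(** * Products of a linear form over the injections *)

Definition injections (m n : nat) : {set {ffun 'I_m -> 'I_n}} :=
  [set s : {ffun _} | injectiveb s].

Definition perm_comp (m n : nat) (t : 'S_n) (s : {ffun 'I_m -> 'I_n}) :=
  [ffun j => t (s j)].

Lemma perm_comp_inj (m n : nat) (t : 'S_n) : injective (@perm_comp m n t).
Proof.
move=> s1 s2 /ffunP E; apply/ffunP => j.
by have := E j; rewrite !ffunE => /perm_inj.
Qed.

Lemma perm_comp_injections (m n : nat) (t : 'S_n) (s : {ffun 'I_m -> 'I_n}) :
  (perm_comp t s \in injections m n) = (s \in injections m n).
Proof.
rewrite !inE; apply/injectiveP/injectiveP => injs j1 j2.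
  by move=> E; apply: injs; rewrite !ffunE E.
by rewrite !ffunE => /perm_inj; exact: injs.
Qed.

(** Double counting: transpositions show that the count does not depend on [i], and the sum over all
    [i] is [m * n ^_ m], since each injection hits [m] indices. Dividing by [n] gives the value. *)
Lemma card_injections_codom (m n : nat) (i : 'I_n) :
  (\sum_(s in injections m n) (i \in codom s) = m * n.-1 ^_ m.-1)%N.
Proof.
pose b i := (\sum_(s in injections m n) (i \in codom s))%N.
have bE j : b j = b i.
  rewrite /b (reindex_inj (@perm_comp_inj m n (tperm i j))) /=.
  apply: eq_big => [s|s _]; first by rewrite perm_comp_injections.
  congr nat_of_bool; apply/codomP/codomP => -[k].
    rewrite ffunE => E; exists k.
    by rewrite -[s k](tpermK i j) -E tpermR.
  by move=> ->; exists k; rewrite ffunE tpermL.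
have Eb : (n * b i = m * n ^_ m)%N.
  transitivity (\sum_j b j)%N.
    by rewrite (eq_bigr _ (fun j _ => bE j)) sum_nat_const card_ord.
  have /esym -> : #|injections m n| = (n ^_ m)%N.
    by rewrite -[in RHS](card_ord n) -[in RHS](card_ord m) -card_inj_ffuns.
  rewrite /b exchange_big /= mulnC -sum_nat_const.
  apply: eq_bigr => s; rewrite inE => /injectiveP injs.
  rewrite -[RHS]card_ord -(card_codom injs) -sum1_card [RHS]big_mkcond /=.
  by apply: eq_bigr => j _; case: (j \in codom s).
have n0 : (0 < n)%N := leq_ltn_trans (leq0n _) (ltn_ord i).
apply/eqP; rewrite -/(b i) -(eqn_pmul2l n0) Eb mulnCA.
by case: m {b bE Eb} => [|m] //=; rewrite ffactnS.
Qed.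

Definition lin_form (m n : nat) (R : comNzRingType) (c : 'I_m -> R)
    (s : 'I_m -> 'I_n) : {mpoly R[n]} := \sum_j c j *: 'X_(s j).

Lemma supp_le_lin_form (m n : nat) (R : comNzRingType) (c : 'I_m -> R)
    (s : 'I_m -> 'I_n) :
  supp_le [multinom (i \in codom s : nat) | i < n] (lin_form c s).
Proof.
apply: supp_le_sum => j _; apply: supp_leZ; apply/supp_leP => m'.
rewrite msuppX inE => /eqP-> i; rewrite mnmE mnm1E.
by case: eqP => // <-; rewrite codom_f.
Qed.

Lemma msym_lin_form (m n : nat) (R : comNzRingType) (c : 'I_m -> R)
    (s : {ffun 'I_m -> 'I_n}) (t : 'S_n) :
  msym t (lin_form c s) = lin_form c (perm_comp t s).
Proof.
rewrite /lin_form rmorph_sum; apply: eq_bigr => j _.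
by rewrite /= msymZ ffunE /msym mmapX mmap1U.
Qed.

(** The elementary symmetric polynomial of degree [k] in the forms [lin_form c s], [s] injective. *)
Definition lin_form_esym (m n : nat) (R : comNzRingType) (c : 'I_m -> R) (k : nat)
    : {mpoly R[n]} :=
  \sum_(T : {set {ffun 'I_m -> 'I_n}} | (T \subset injections m n) && (#|T| == k))
    \prod_(s in T) lin_form c s.

(** Permuting the variables permutes the forms, hence the sets of [k] of them. *)
Lemma lin_form_esym_sym (m n : nat) (R : comNzRingType) (c : 'I_m -> R) (k : nat) :
  lin_form_esym n c k \is symmetric.
Proof.
apply/issymP => t; rewrite /lin_form_esym rmorph_sum /=.
rewrite [RHS](reindex_inj (imset_inj (@perm_comp_inj m n t))) /=.
apply: eq_big => [T|T _].
  rewrite card_imset; last exact: perm_comp_inj.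
  rewrite sub_imset_pre.
  suff -> : perm_comp t @^-1: injections m n = injections m n by [].
  by apply/setP => s; rewrite inE perm_comp_injections.
rewrite rmorph_prod big_imset /=; last by move=> ? ? _ _; exact: perm_comp_inj.
by apply: eq_bigr => s _; rewrite msym_lin_form.
Qed.

(** A variable occurs, to degree at most 1, only in the forms whose injection hits its index, and
    these have been counted. *)
Lemma supp_le_lin_form_esym (m n : nat) (R : comNzRingType) (c : 'I_m -> R) (k : nat) :
  supp_le [multinom (m * n.-1 ^_ m.-1)%N | i < n] (lin_form_esym n c k).
Proof.
apply: supp_le_sum => T /andP[/subsetP sT _].
apply: supp_le_trans; last by apply: supp_le_prod => s _; exact: supp_le_lin_form.
apply/mnm_lepP => i; rewrite mnm_sumE !mnmE -(card_injections_codom m i).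
rewrite big_mkcond [X in (_ <= X)%N]big_mkcond; apply: leq_sum => s _.
by case: ifP => // /sT ->; rewrite mnmE.
Qed.

Definition lin_val (m n : nat) (C : nzRingType) (c : 'I_m -> int)
    (h : 'I_n -> C) (s : 'I_m -> 'I_n) : C := \sum_j (c j)%:~R * h (s j).

(** With [k] the number of forms not vanishing at the roots, [lin_form_esym] reduces to their
    product; scaled by the power of [a] it is a nonzero integer. *)
Lemma prod_lin_val_ge1 (m n : nat) (C : numFieldType) (c : 'I_m -> int)
    (h : 'I_n -> C) (a : C) (P : {poly int}) :
  map_poly intr P = a *: \prod_(i < n) ('X - (h i)%:P) -> a != 0 ->
  1 <= `|a| ^+ (m * n.-1 ^_ m.-1) *
       \prod_(s in injections m n | lin_val c h s != 0)
    `|lin_val c h s|.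
Proof.
move=> EP nz_a; set L := lin_val c h; pose S := [set s in injections m n | L s != 0].
have EL s : mmap intr h (lin_form c s) = L s.
  rewrite /lin_form rmorph_sum; apply: eq_bigr => j _.
  by rewrite /= mmapZ mmapX mmap1U.
have [z] := sym_eval_roots EP (lin_form_esym_sym n c #|S|)
  (supp_le_lin_form_esym n c #|S|).
rewrite [X in _ * X]rmorph_sum (bigD1 S) /=; last first.
  by rewrite eqxx andbT; apply/subsetP => s; rewrite inE => /andP[].
(* Any other set of [#|S|] injections contains one outside [S], where the form vanishes. *)
rewrite [X in _ + X]big1 ?addr0; last first.
  move=> T /andP[/andP[sT /eqP cT] neT]; rewrite rmorph_prod.
  have /subsetPn [s sinT snS] : ~~ (T \subset S).
    by apply: contra neT => sTS; rewrite eqEcard sTS cT leqnn.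
  rewrite (bigD1 s) //= EL; move: snS; rewrite inE (subsetP sT) //= negbK.
  by move=> /eqP ->; rewrite mul0r.
rewrite rmorph_prod /= (eq_bigr (fun s : {ffun 'I_m -> 'I_n} => L s)) => [|s _ //].
rewrite (eq_bigl (fun s => (s \in injections m n) && (L s != 0))); last first.
  by move=> s; rewrite [LHS]inE.
move=> Ez; rewrite -normrX -normr_prod -normrM -Ez -intr_norm ler1z -gtz0_ge1.
rewrite normr_gt0 -(intr_eq0 C) Ez mulf_neq0 ?expf_neq0 //.
by apply/prodf_neq0 => s /andP[].
Qed.

(** * Upper bounds by the height *)

(** The coefficients of [q] are recovered from those of the product by a recurrence, run from the
    top if [z] has modulus at most 1 and from the bottom otherwise. Each step then adds at most [B],
    and there are at most [n] steps. *)
Lemma norm_div_root (C : numFieldType) (n : nat) (q : {poly C}) (z B : C) :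
  (size q <= n)%N -> (forall k, `|(q * ('X - z%:P))`_k| <= B) ->
  forall k, (1 + `|z|) * `|q`_k| <= (2 * n)%:R * B.
Proof.
move=> sq hB k; have B0 : 0 <= B := le_trans (normr_ge0 _) (hB 0%N).
have Ep j : (q * ('X - z%:P))`_j.+1 = q`_j - z * q`_j.+1.
  by rewrite mulrBr coefB coefMX coefMC /= [z * _]mulrC.
have [lekn|ltkn] := leqP n k.
  by rewrite nth_default ?(leq_trans sq) // normr0 mulr0 mulr_ge0 ?ler0n.
suff [h1 h2] : `|q`_k| <= n%:R * B /\ `|z * q`_k| <= n%:R * B.
  by rewrite mulrDl mul1r -normrM mul2n -addnn natrD mulrDl lerD.
case: (real_leP (normr_real z) (@real1 C)) => hz.
  have h j : (j <= n)%N -> `|q`_(n - j)| <= j%:R * B.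
    elim: j => [|j ih] ltj.
      by rewrite subn0 nth_default // normr0 mul0r.
    have -> : q`_(n - j.+1) =
        (q * ('X - z%:P))`_(n - j) + z * q`_(n - j).
      by rewrite -(subnSK ltj) Ep subrK.
    rewrite -natr1 mulrDl mul1r addrC (le_trans (ler_normD _ _)) // lerD //.
    rewrite normrM (le_trans _ (ih (ltnW ltj))) //.
    by rewrite ler_piMl.
  have h1 : `|q`_k| <= n%:R * B.
    rewrite -(subKn (ltnW ltkn)) (le_trans (h _ (leq_subr _ _))) //.
    by rewrite ler_wpM2r // ler_nat leq_subr.
  by split => //; rewrite normrM (le_trans _ h1) // ler_piMl.
have h j : `|z * q`_j| <= j.+1%:R * B.
  elim: j => [|j ih].
    have := hB 0%N; rewrite mulrBr coefB coefMX coefMC /= sub0r normrN.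
    by rewrite mulrC mul1r.
  have -> : z * q`_j.+1 = q`_j - (q * ('X - z%:P))`_j.+1.
    by rewrite Ep opprB addrC subrK.
  rewrite -natr1 mulrDl mul1r (le_trans (ler_normB _ _)) // lerD //.
  by rewrite (le_trans _ ih) // normrM ler_peMl // ltW.
have h2 : `|z * q`_k| <= n%:R * B.
  by rewrite (le_trans (h k)) // ler_wpM2r // ler_nat.
by split => //; rewrite (le_trans _ h2) // normrM ler_peMl // ltW.
Qed.

(** Roots are divided out one at a time. The product of the [1 + |z|] dominates that of the
    [max(1, |z|)], so this bounds the Mahler measure. *)
Lemma norm_prod_roots_le (C : numFieldType) (n : nat) (r : seq C) (a B : C) :
  (size r <= n)%N ->
  (forall k, `|(a *: \prod_(z <- r) ('X - z%:P))`_k| <= B) ->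
  `|a| * \prod_(z <- r) (1 + `|z|) <= (2 * n)%:R ^+ size r * B.
Proof.
elim: r B => [|z r ih] B /=.
  by move=> _ /(_ 0%N); rewrite !big_nil coefZ coef1 mulr1 expr0 mul1r mulr1.
move=> ltr; rewrite !big_cons [('X - _) * _]mulrC [(1 + _) * _]mulrC scalerAl => hB.
have z1 : 0 < 1 + `|z| by rewrite ltr_wpDr.
rewrite mulrA -ler_pdivlMr //.
rewrite -mulrA exprSr -!mulrA; apply: ih; first exact: ltnW.
have := norm_div_root _ hB; move/(_ n) => hq k.
rewrite mulrA ler_pdivlMr // mulrC; apply: hq.
by rewrite (leq_trans (size_scale_leq _ _)) // size_prod_XsubC.
Qed.

Lemma absz_coef_le_height (P : {poly int}) (k : nat) : (`|(P`_k)%R| <= height P)%N.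
Proof.
have [ltk|lek] := ltnP k (size P); last by rewrite nth_default.
exact: (@leq_bigmax _ (fun i : 'I_(size P) => `|(P`_i)%R|%N) (Ordinal ltk)).
Qed.

(** The successor in the constant keeps the right-hand side at least 1, even if all coefficients are
    0. *)
Lemma norm_lin_val_le (m n : nat) (C : numFieldType) (c : 'I_m -> int)
    (h : 'I_n -> C) (s : 'I_m -> 'I_n) :
  `|lin_val c h s| <=
    (\sum_j `|c j|)%N.+1%:R * \prod_i (1 + `|h i|) ^+ (i \in codom s).
Proof.
set w := \prod_i _.
have h1 i : 1 <= (1 + `|h i|) ^+ (i \in codom s).
  by rewrite exprn_ege1 // lerDl.
have w0 : 0 <= w by apply: prodr_ge0 => i _; rewrite (le_trans ler01).
rewrite (le_trans (ler_norm_sum _ _ _)) // -natr1 mulrDl mul1r ler_wpDr //.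
rewrite natr_sum mulr_suml; apply: ler_sum => j _.
rewrite normrM -intr_norm -natr_absz ler_wpM2l //.
rewrite /w (bigD1 (s j)) //= codom_f expr1.
apply: le_trans (_ : 1 + `|h (s j)| <= _); first by rewrite lerDr.
rewrite ler_peMr ?addr_ge0 //; elim/big_rec: _ => // i x _ hx.
by rewrite mulr_ege1.
Qed.

(** * Lower bound for a repeated absolute value *)

Lemma lin_val_lower_bound (m n : nat) (c : 'I_m -> int) :
  exists2 K : nat, (0 < K)%N &
  forall (C : numFieldType) (P : {poly int}) (h : 'I_n -> C)
         (A : {set {ffun 'I_m -> 'I_n}}) (x : C),
    P != 0 -> map_poly intr P = (lead_coef P)%:~R *: \prod_(i < n) ('X - (h i)%:P) ->
    A \subset injections m n -> 0 < x -> (forall s, s \in A -> `|lin_val c h s| = x) ->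
    1 <= K%:R * (height P)%:R ^+ (m * n.-1 ^_ m.-1) * x ^+ #|A|.
Proof.
pose B := (\sum_j `|c j|)%N.+1; pose N := (m * n.-1 ^_ m.-1)%N.
(* One [B] comes from each form, and [(2 * n) ^ n] from each of the [N] uses of the bound on the
   roots. *)
exists (B ^ #|injections m n| * ((2 * n) ^ n) ^ N)%N.
  rewrite muln_gt0 !expn_gt0 /=.
  by case: (posnP n) => [->|n0] //; rewrite ?muln_gt0 ?n0.
move=> C P h A x nz_P EP sA x0 hA; set a : C := (lead_coef P)%:~R.
have nz_a : a != 0 by rewrite intr_eq0 lead_coef_eq0.
pose w (s : {ffun 'I_m -> 'I_n}) := \prod_i (1 + `|h i|) ^+ (i \in codom s).
have w1 s : 1 <= B%:R * w s.
  rewrite mulr_ege1 ?ler1n //; rewrite /w; elim/big_rec: _ => // i y _ hy.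
  by rewrite mulr_ege1 // exprn_ege1 // lerDl.
have w0 s : 0 <= B%:R * w s := le_trans ler01 (w1 s).
(* Each factor is bounded by [B%:R * w s], times [x] when [s] lies in [A]. As [B%:R * w s] is at
   least 1, the bound also holds for the factors in [A] and for the omitted vanishing forms. *)
have hprod : \prod_(s in injections m n | lin_val c h s != 0) `|lin_val c h s| <=
    x ^+ #|A| * (B%:R ^+ #|injections m n| * (\prod_i (1 + `|h i|)) ^+ N).
  have -> : x ^+ #|A| = \prod_(s in injections m n) (if s \in A then x else 1).
    rewrite -big_mkcondr /= (eq_bigl (mem A)) ?prodr_const // => s /=.
    by rewrite andb_idl // => /(subsetP sA).
  have -> : B%:R ^+ #|injections m n| * (\prod_i (1 + `|h i|)) ^+ N =
      \prod_(s in injections m n) (B%:R * w s).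
    rewrite big_split prodr_const /=; congr (_ * _).
    (* Each root is hit by exactly [N] injections. *)
    rewrite /w exchange_big /= -prodrXl; apply: eq_bigr => i _.
    by rewrite prodrXr card_injections_codom.
  rewrite -big_split /= big_mkcondr /=; apply: ler_prod => s _.
  apply/andP; split; first by case: ifP.
  case: (boolP (s \in A)) => [sA'|_].
    rewrite hA //; case: ifPn => [_|]; first by rewrite ler_peMr // ltW.
    by rewrite -normr_eq0 hA // gt_eqF.
  by rewrite mul1r; case: ifP => // _; exact: norm_lin_val_le.
have hmahler : `|a| * \prod_i (1 + `|h i|) <= (2 * n)%:R ^+ n * (height P)%:R.
  have := @norm_prod_roots_le C n [seq h i | i <- index_enum 'I_n] a (height P)%:R.
  rewrite size_map /index_enum -enumT size_enum_ord !big_map; apply => // k.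
  by rewrite -EP coef_map -intr_norm -natr_absz ler_nat absz_coef_le_height.
apply: le_trans (prod_lin_val_ge1 c EP nz_a) _.
apply: le_trans (ler_wpM2l (exprn_ge0 _ (normr_ge0 _)) hprod) _.
rewrite mulrCA [X in _ * X]mulrCA -exprMn [leRHS]mulrC ler_pM2l ?exprn_gt0 //.
rewrite natrM !natrX -mulrA -exprMn ler_wpM2l ?exprn_ge0 //.
rewrite lerXn2r // nnegrE ?mulr_ge0 ?exprn_ge0 //.
by apply: prodr_ge0 => i _; rewrite addr_ge0.
Qed.

(** * Purely imaginary values of a form at complex roots *)

Lemma roots_family (C : closedFieldType) (n : nat) (P : {poly int}) (f : {rmorphism int -> C}) :
  injective f -> size P = n.+1 ->
  exists2 h : 'I_n -> C,
    map_poly f P = f (lead_coef P) *: \prod_(i < n) ('X - (h i)%:P) &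
    forall z, root (map_poly f P) z -> exists i, h i = z.
Proof.
move=> injf sP; have [r Er] := closed_field_poly_normal (map_poly f P).
have nz_P : P != 0 by rewrite -size_poly_eq0 sP.
have lE : lead_coef (map_poly f P) = f (lead_coef P).
  by rewrite lead_coef_map_inj // rmorph0.
have nz_l : f (lead_coef P) != 0.
  by rewrite -(rmorph0 f) (inj_eq injf) lead_coef_eq0.
have sr : size r = n.
  have := congr1 (size : {poly C} -> nat) Er.
  rewrite size_map_inj_poly ?rmorph0 // sP lE size_scale //.
  by rewrite size_prod_XsubC => -[].
exists (fun i => r`_i) => [|z].
  by rewrite {1}Er lE (big_nth 0) big_mkord sr.
rewrite Er lE rootZ // root_prod_XsubC => /(nthP 0)[i lti <-].
by rewrite sr in lti; exists (Ordinal lti).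
Qed.

Lemma root_conjc (R : rcfType) (P : {poly int}) (z : complex R) :
  root (map_poly intr P) z -> root (map_poly intr P) (conjc z).
Proof.
move=> rz; suff -> : map_poly intr P = map_poly (@conjc R) (map_poly intr P).
  exact: rmorph_root.
by rewrite -map_poly_comp; apply: eq_map_poly => k /=; rewrite rmorph_int.
Qed.

Lemma normc_imag (R : rcfType) (w : complex R) :
  complex.Re w = 0 -> `|w| = (`|complex.Im w|)%:C%C.
Proof.
by case: w => a b /= ->; rewrite normc_def /= expr0n add0r sqrtr_sqr.
Qed.

Lemma height_gt0 (P : {poly int}) : P != 0 -> (0 < height P)%N.
Proof.
move=> nz_P; apply: leq_trans (absz_coef_le_height P (size P).-1).
by rewrite absz_gt0 lead_coef_eq0.
Qed.

(** Distinct tuples of roots give distinct injections into the indices, so [|w|] occurs at least [t]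
    times; since the exponent is [E * t], a [t]-th root can be taken. The tuples need only be
    evaluated up to sign. *)
Lemma root_form_lower_bound (R : rcfType) (n m t E : nat) (c : m.-tuple int) :
  (0 < t)%N -> (m * n.-1 ^_ m.-1 = E * t)%N ->
  exists2 c0 : R, 0 < c0 &
  forall (P : {poly int}) (V : t.-tuple (m.-tuple (complex R))) (w : complex R),
    size P = n.+1 -> complex.Re w = 0 -> complex.Im w != 0 -> uniq V ->
    (forall v, v \in V -> [/\ uniq v, {in v, forall z, root (map_poly intr P) z} &
      \sum_j (tnth c j)%:~R * tnth v j = w \/ \sum_j (tnth c j)%:~R * tnth v j = - w]) ->
    c0 * (height P)%:R ^- E <= `|complex.Im w|.
Proof.
move=> t0 EN; have [K K0 hK] := lin_val_lower_bound n (tnth c).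
exists K%:R^-1; first by rewrite invr_gt0 ltr0n.
move=> P V w sP Rew; set y := complex.Im w => nz_y uV hV.
have nz_P : P != 0 by rewrite -size_poly_eq0 sP.
(* A multiple root has several indices; any choice serves, since distinct roots have distinct
   indices. *)
have [h EP rootsP] := roots_family (@intr_inj (complex R)) sP.
have /fin_all_exists [S ES] : forall u : 'I_t,
    exists s : {ffun 'I_m -> 'I_n}, forall j, h (s j) = tnth (tnth V u) j.
  move=> u; have [_ rV _] := hV _ (mem_tnth u V).
  have /fin_all_exists [s Es] j := rootsP _ (rV _ (mem_tnth j _)).
  by exists (finfun s) => j; rewrite ffunE.
have injS : injective S.
  move=> u1 u2 E12; apply/(tuple_uniqP _ uV)/eq_from_tnth => j.
  by rewrite -!ES E12.
pose x : complex R := (`|y|)%:C%C.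
have x0 : 0 < x by rewrite ltcR normr_gt0.
have := hK _ P h (S @: setT) x nz_P EP.
rewrite card_imset // cardsT card_ord EN => h1.
have {h1} : 1 <= K%:R * (height P)%:R ^+ (E * t) * x ^+ t.
  apply: h1 => // [|s /imsetP[u _ ->]].
    apply/subsetP => s /imsetP[u _ ->]; rewrite inE; apply/injectiveP => j1 j2 Ej.
    have [uv _ _] := hV _ (mem_tnth u V).
    by apply/(tuple_uniqP _ uv); rewrite -!ES Ej.
  have -> : lin_val (tnth c) h (S u) = \sum_j (tnth c j)%:~R * tnth (tnth V u) j.
    by apply: eq_bigr => j _; rewrite ES.
  rewrite /x -normc_imag //.
  by have [_ _ [->|->]] := hV _ (mem_tnth u V); rewrite ?normrN.
have -> : K%:R * (height P)%:R ^+ (E * t) * x ^+ t =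
    (K%:R * (height P)%:R ^+ (E * t) * `|y| ^+ t)%:C%C.
  by rewrite !rmorphM /= !rmorphXn /= !rmorph_nat.
rewrite lecR => h1.
have H0 : 0 < (height P)%:R ^+ E :> R by rewrite exprn_gt0 // ltr0n height_gt0.
(* As [K] is at least 1, it may be replaced by its [t]-th power. *)
have : 1 <= (K%:R * (height P)%:R ^+ E * `|y|) ^+ t.
  rewrite (le_trans h1) // !exprMn exprM.
  rewrite ler_wpM2r ?exprn_ge0 // ler_wpM2r ?exprn_ge0 //.
  by rewrite ler_eXnr // ler1n.
rewrite expr_ge1 //; last by rewrite !mulr_ge0 // ltW.
by rewrite -invfM -[_^-1]mulr1 ler_pdivrMl // mulr_gt0 // ltr0n.
Qed.

(** * The three linear forms *)

(** The orbit of [(a, b, c, d)] under the symmetries of [X - Y - Z + W] up to sign: the first four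
    arrangements preserve [a - b - c + d], the last four, which exchange [{a, d}] and [{b, c}],
    negate it. *)
Lemma uniq_swaps (T : eqType) (a b c d : T) :
  let V := [tuple [tuple a; b; c; d]; [tuple d; b; c; a]; [tuple a; c; b; d];
             [tuple d; c; b; a]; [tuple b; a; d; c]; [tuple b; d; a; c];
             [tuple c; a; d; b]; [tuple c; d; a; b]] in
  uniq [:: a; b; c; d] ->
  uniq V /\ {in V, forall v : 4.-tuple T, uniq v /\ v =i [:: a; b; c; d]}.
Proof.
move=> V; rewrite /= !inE !negb_or -!andbA => /and5P[ab ac ad bc /and3P[bd cd _]].
have E x y : x != y :> T -> (x == y = false) * (y == x = false).
  by move=> /negbTE h; rewrite [y == x]eq_sym h.
have Es := (E _ _ ab, E _ _ ac, E _ _ ad, E _ _ bc, E _ _ bd, E _ _ cd).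
split.
  by rewrite -!val_eqE /= !eqseq_cons !Es ?eqxx ?andbF ?andbT.
move=> v; rewrite !inE; do ![case/orP]; move=> /eqP->; split.
all: try by rewrite /= !inE !Es.
all: by move=> x; rewrite !inE; case: (x == a); case: (x == b); case: (x == c); case: (x == d).
Qed.

Section ImaginaryParts.

Variables (R : rcfType) (n : nat).
Implicit Types (P : {poly int}) (z : complex R).

Local Notation proot P z := (root (map_poly intr P) z).

Lemma conjc_eq z : (z == conjc z) = (complex.Im z == 0).
Proof.
case: z => x y /=; rewrite eq_complex /= eqxx /=.
by rewrite -subr_eq0 opprK -mulr2n mulrn_eq0.
Qed.

Lemma Im_root_lower_bound :
  exists2 c : R, 0 < c & forall P z, size P = n.+1 -> proot P z ->
    complex.Im z != 0 -> c * (height P)%:R ^- (n - 1) <= `|complex.Im z|.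
Proof.
have [|c0 c00 hc] := @root_form_lower_bound R n 2 2 (n - 1) [tuple 1; -1] isT.
  by rewrite /= ffactn1 mulnC subn1.
(* The form takes a value with twice the imaginary part wanted, whence the division by 2. *)
exists (c0 / 2) => [|P z sP rz nz_z]; first by rewrite divr_gt0.
have nz : z != conjc z by rewrite conjc_eq.
have rcz := root_conjc rz.
have Im2 : complex.Im (z - conjc z) = complex.Im z *+ 2.
  by case: (z) => x y /=; rewrite opprK.
rewrite mulrAC ler_pdivrMr // mulr_natr -normrMn -Im2.
apply: (hc P [tuple [tuple z; conjc z]; [tuple conjc z; z]] _ sP).
- by case: (z) => x y /=; rewrite subrr.
- by rewrite Im2 mulrn_eq0.
- by rewrite /= !inE -val_eqE /= eqseq_cons (negbTE nz).
move=> v; rewrite !inE => /orP[]/eqP ->.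
  split; first by rewrite /= inE nz.
    by move=> u; rewrite !inE => /orP[]/eqP ->.
  rewrite !big_ord_recl big_ord0 !(tnth_nth 0) /=; left; ring.
split; first by rewrite /= inE eq_sym nz.
  by move=> u; rewrite !inE => /orP[]/eqP ->.
rewrite !big_ord_recl big_ord0 !(tnth_nth 0) /=; right; ring.
Qed.

Lemma Im_diff_imag_lower_bound :
  exists2 c : R, 0 < c & forall P z1 z2, size P = n.+1 -> proot P z1 -> proot P z2 ->
    complex.Re z1 = 0 -> complex.Im z1 != complex.Im z2 -> complex.Im z2 != 0 ->
    z1 != conjc z2 ->
    c * (height P)%:R ^- (3 * (n - 1) * (n - 2) %/ 2)
      <= `|complex.Im z1 - complex.Im z2|.
Proof.
have [|c0 c00 hc] := @root_form_lower_bound R n 3 2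
    (3 * (n - 1) * (n - 2) %/ 2) [tuple 2; -1; 1] isT.
  (* The halved exponent is exact: [n - 1] and [n - 2] are consecutive, or their product is 0. *)
  rewrite divnK; first by rewrite !ffactnSr /= ffactn0 subn0 -subn1; lia.
  rewrite dvdn2 !oddM; case: (n) => [|[|k]] //=.
  by rewrite !subSS subn0 /=; case: (odd k).
exists (c0 / 2) => [|P z1 z2 sP rz1 rz2 Re1 ne12 nz2 n1c2]; first by rewrite divr_gt0.
have n12 : z1 != z2 by apply: contraNneq ne12 => ->.
have n2c : z2 != conjc z2 by rewrite conjc_eq.
have nc1c2 : conjc z1 != conjc z2 by rewrite (inj_eq (can_inj (@conjcK R))).
have nc12 : conjc z1 != z2 by rewrite -[z2]conjcK (inj_eq (can_inj (@conjcK R))).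
have rcz1 := root_conjc rz1; have rcz2 := root_conjc rz2.
have Imw : complex.Im (2 * z1 - z2 + conjc z2) = (complex.Im z1 - complex.Im z2) *+ 2.
  by case: (z1) (z2) => x1 y1 [x2 y2] /=; ring.
rewrite mulrAC ler_pdivrMr // mulr_natr -normrMn -Imw.
have Ec1 : conjc z1 = - z1.
  by case: (z1) Re1 => x y /= ->; apply/eqP; rewrite eq_complex /= oppr0 !eqxx.
(* The value is purely imaginary because [z1] is, so conjugation negates it. The two tuples differ
   in their second entry, even if [z1] is 0. *)
apply: (hc P [tuple [tuple z1; z2; conjc z2]; [tuple conjc z1; conjc z2; z2]] _ sP).
- by case: (z1) (z2) Re1 => x1 y1 [x2 y2] /= ->; ring.
- by rewrite Imw mulrn_eq0 /= subr_eq0.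
- by rewrite /= !inE -val_eqE /= !eqseq_cons (negbTE n2c) andbF.
move=> v; rewrite !inE => /orP[]/eqP ->.
  split; first by rewrite /= !inE negb_or n12 n1c2 n2c.
    by move=> u; rewrite !inE => /or3P[]/eqP ->.
  by rewrite !big_ord_recl big_ord0 !(tnth_nth 0) /=; left; ring.
split; first by rewrite /= !inE negb_or nc12 nc1c2 eq_sym n2c.
  by move=> u; rewrite !inE => /or3P[]/eqP ->.
by rewrite !big_ord_recl big_ord0 !(tnth_nth 0) /= Ec1; right; ring.
Qed.

Lemma Im_diff_lower_bound :
  exists2 c : R, 0 < c & forall P z1 z2, size P = n.+1 -> proot P z1 -> proot P z2 ->
    complex.Im z1 != complex.Im z2 -> complex.Im z1 != 0 -> complex.Im z2 != 0 ->
    z1 != conjc z2 ->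
    c * (height P)%:R ^- ((n - 1) * (n - 2) * (n - 3) %/ 2)
      <= `|complex.Im z1 - complex.Im z2|.
Proof.
have [|c0 c00 hc] := @root_form_lower_bound R n 4 8
    ((n - 1) * (n - 2) * (n - 3) %/ 2) [tuple 1; -1; -1; 1] isT.
  rewrite (_ : 8 = 2 * 4)%N // mulnA divnK.
    by rewrite !ffactnSr /= ffactn0 !subn0 -subn1 mulnC mul1n -!subnDA.
  rewrite dvdn2 !oddM; case: (n) => [|[|k]] //=.
  by rewrite !subSS subn0 /=; case: (odd k).
exists (c0 / 2) => [|P z1 z2 sP rz1 rz2 ne12 nz1 nz2 n1c2]; first by rewrite divr_gt0.
have n12 : z1 != z2 by apply: contraNneq ne12 => ->.
have n1c : z1 != conjc z1 by rewrite conjc_eq.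
have n2c : z2 != conjc z2 by rewrite conjc_eq.
have nc1c2 : conjc z1 != conjc z2 by rewrite (inj_eq (can_inj (@conjcK R))).
have nc12 : conjc z1 != z2 by rewrite -[z2]conjcK (inj_eq (can_inj (@conjcK R))).
have rcz1 := root_conjc rz1; have rcz2 := root_conjc rz2.
pose a := z1; pose b := conjc z1; pose c := z2; pose d := conjc z2.
(* The hypotheses on [z1] and [z2] amount to these four roots being distinct. *)
have U : uniq [:: a; b; c; d].
  by rewrite /= !inE !negb_or n12 n1c n2c nc1c2 nc12 n1c2.
have Imw : complex.Im (a - b - c + d) = (complex.Im z1 - complex.Im z2) *+ 2.
  by rewrite /a /b /c /d; case: (z1) (z2) => x1 y1 [x2 y2] /=; ring.
rewrite mulrAC ler_pdivrMr // mulr_natr -normrMn -Imw.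
apply: (hc P [tuple [tuple a; b; c; d]; [tuple d; b; c; a]; [tuple a; c; b; d];
           [tuple d; c; b; a]; [tuple b; a; d; c]; [tuple b; d; a; c];
           [tuple c; a; d; b]; [tuple c; d; a; b]] _ sP).
- by rewrite /a /b /c /d; case: (z1) (z2) => x1 y1 [x2 y2] /=; ring.
- by rewrite Imw mulrn_eq0 /= subr_eq0.
- exact: (uniq_swaps U).1.
move=> v vV; have [uv Ev] := (uniq_swaps U).2 _ vV; split=> //.
  by move=> u; rewrite Ev !inE => /or4P[]/eqP->.
rewrite !big_ord_recl big_ord0; move: vV; rewrite !inE.
do ![case/orP]; move=> /eqP->; rewrite !(tnth_nth 0) /=.
1-4: by left; ring.
all: by right; ring.
Qed.

End ImaginaryParts.

(* In degree 2 (for Re alpha = 0) and in degrees 2 and 3 (in the last case) the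
   exponent degenerates to 0 and the bound fails, e.g. for n X^2 + 1 and
   (n X^2 + X + 1) (X - 1); whence the conditions on d in these two cases. *)
Theorem theorem4 (R : realType) (d : nat) :
  exists2 c : R, 0 < c &
    forall (P : {poly int}) (alpha beta : complex R),
      size P = d.+1 ->
      complex_root P alpha -> complex_root P beta ->
      complex.Im alpha <> complex.Im beta ->
      [/\ complex.Im alpha = 0 ->
            c * (height P)%:R ^- (d - 1)
              <= `|complex.Im alpha - complex.Im beta|,
          (2 < d)%N -> complex.Re alpha = 0 ->
            c * (height P)%:R ^- (3 * (d - 1) * (d - 2) %/ 2)
              <= `|complex.Im alpha - complex.Im beta|
        & (3 < d)%N -> complex.Im alpha <> 0 -> complex.Re alpha <> 0 ->
            c * (height P)%:R ^- ((d - 1) * (d - 2) * (d - 3) %/ 2)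
              <= `|complex.Im alpha - complex.Im beta| ].
Proof.
have [c1 c10 h1] := Im_root_lower_bound R d.
have [c2 c20 h2] := Im_diff_imag_lower_bound R d.
have [c3 c30 h3] := Im_diff_lower_bound R d.
exists (Num.min c1 (Num.min c2 c3)) => [|P z1 z2 sP r1 r2 /eqP ne12].
  by rewrite !lt_min c10 c20.
have H1 : 1 <= (height P)%:R :> R.
  by rewrite ler1n height_gt0 // -size_poly_eq0 sP.
(* The height is at least 1, so raising the exponent only weakens the bound. *)
have le_pow c e e' x : 0 < c -> (e <= e')%N -> Num.min c1 (Num.min c2 c3) <= c ->
    c * (height P)%:R ^- e <= x ->
    Num.min c1 (Num.min c2 c3) * (height P)%:R ^- e' <= x.
  move=> c0 lee lec; apply: le_trans.
  apply: ler_pM => //; first by rewrite !le_min !ltW.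
    by rewrite invr_ge0 exprn_ge0.
  rewrite lef_pV2 ?posrE ?exprn_gt0 ?(lt_le_trans ltr01 H1) //.
  exact: ler_weXn2l.
have [m1 [m2 m3]] : Num.min c1 (Num.min c2 c3) <= c1 /\
    Num.min c1 (Num.min c2 c3) <= c2 /\ Num.min c1 (Num.min c2 c3) <= c3.
  by split; [|split]; rewrite !ge_min lexx ?orbT.
(* In these degenerate cases the difference is, up to sign, [Im z1], [Im z2] or [2 * Im z2], and
   nonzero. *)
have real_or_conj e : complex.Im z1 = 0 \/ complex.Im z2 = 0 \/ z1 = conjc z2 ->
    (d - 1 <= e)%N -> Num.min c1 (Num.min c2 c3) * (height P)%:R ^- e
      <= `|complex.Im z1 - complex.Im z2|.
  move=> hz lee; apply: (le_pow c1 (d - 1)%N) => //.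
  case: hz => [z10|[z20|z12]].
  - by rewrite z10 sub0r normrN; apply: h1 => //; rewrite -z10 eq_sym.
  - by rewrite z20 subr0; apply: h1 => //; rewrite -z20.
  - have E : complex.Im z1 = - complex.Im z2 by rewrite z12; case: (z2).
    rewrite E -opprD normrN -mulr2n normrMn mulr2n.
    rewrite (le_trans (h1 _ _ sP r2 _)) ?lerDl //.
    by apply: contraNneq ne12 => z20; rewrite E z20 oppr0.
split=> [z10|d2 Re1|d3 nz1 _].
- by apply: real_or_conj => //; left.
- have le_e : (d - 1 <= 3 * (d - 1) * (d - 2) %/ 2)%N.
    by rewrite leq_divRL //; nia.
  have [z10|nz1] := eqVneq (complex.Im z1) 0; first by apply: real_or_conj => //; left.
  have [z20|nz2] := eqVneq (complex.Im z2) 0; first by apply: real_or_conj => //; right; left.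
  have [z12|n1c2] := eqVneq z1 (conjc z2); first by apply: real_or_conj => //; right; right.
  by apply: le_pow (h2 _ _ _ sP r1 r2 Re1 ne12 nz2 n1c2).
(* For [d] equal to 4 both sides are 3. *)
- have le_e : (d - 1 <= (d - 1) * (d - 2) * (d - 3) %/ 2)%N.
    by rewrite leq_divRL //; nia.
  have [z20|nz2] := eqVneq (complex.Im z2) 0; first by apply: real_or_conj => //; right; left.
  have [z12|n1c2] := eqVneq z1 (conjc z2); first by apply: real_or_conj => //; right; right.
  by apply: le_pow (h3 _ _ _ sP r1 r2 ne12 _ nz2 n1c2) => //; apply/eqP.
Qed.
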